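(* Let $p>3$ be a prime, let $a\in\mathbb{Z}_p$ with $a\not\equiv0\pmod p$, and let $\langle a\rangle_p$ be the least nonnegative residue of $a$ modulo $p$. Then $$\sum_{k=0}^{(p-1)/2}\binom ak\binom{-1-a}k\frac1{2k-1}\equiv\begin{cases}-(2a+1)+2(a-\langle a\rangle_p)\big(1+(2a+1)E_{p-2}(-2a)\big)\pmod{p^2}&\text{if }\langle a\rangle_p<\frac p2,\\ 2a+1+2(p+a-\langle a\rangle_p)\big(1+(2a+1)E_{p-2}(-2a)\big)\pmod{p^2}&\text{if }\langle a\rangle_p>\frac p2.\end{cases}$$
   Context: $\mathbb{Z}_p$ denotes the set of rational numbers whose denominator is not divisible by $p$; congruences modulo $p^m$ are taken in $\mathbb{Z}_p$. For $a\in\mathbb{Z}_p$, $\langle a\rangle_p\in\{0,1,\dots,p-1\}$ satisfies $\langle a\rangle_p\equiv a\pmod p$. $\binom xk=x(x-1)\cdots(x-k+1)/k!$. The Euler numbers are defined by $E_0=1$, $E_n=-\sum_{k=1}^{[n/2]}\binom n{2k}E_{n-2k}$ ($n\ge1$), and the Euler polynomials by $E_n(x)=2^{-n}\sum_{r=0}^n\binom nr(2x-1)^{n-r}E_r$. *)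

(* Defs.v *)
From mathcomp Require Import all_boot all_order all_algebra.
From mathcomp Require Import ring.
Set Implicit Arguments.
Unset Strict Implicit.
Unset Printing Implicit Defensive.
Import Order.TTheory GRing.Theory Num.Theory.
Local Open Scope ring_scope.

Definition pintegral (p : nat) : {pred rat} :=
  fun x => ~~ (p %| `|denq x|)%N.

(* x = y mod p ^ m in Z_(p), i.e. x - y lies in p ^ m Z_(p). *)
Definition pcong (p m : nat) (x y : rat) : bool :=
  (x - y) / (p ^ m)%:R \in pintegral p.

(* For p prime and a in Z_(p), the search succeeds (see pcong_presidue). *)
Definition presidue (p : nat) (a : rat) : nat :=
  find (fun r => pcong p 1 a r%:R) (iota 0 p).

Definition gbinom (x : rat) (k : nat) : rat :=
  (\prod_(i < k) (x - i%:R)) / (k`!)%:R.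

(* The list [:: E_0; ...; E_n]; euler_num0 and euler_numS below give the
   usual recursion. *)
Fixpoint euler_seq (n : nat) : seq int :=
  if n is m.+1 then
    let s := euler_seq m in
    rcons s (- \sum_(1 <= k < (n./2).+1) ('C(n, k.*2))%:R * s`_(n - k.*2))
  else [:: 1].

Definition euler_num (n : nat) : int := (euler_seq n)`_n.

Definition euler_poly (n : nat) (x : rat) : rat :=
  2%:R ^- n *
  \sum_(r < n.+1) ('C(n, r))%:R * (2%:R * x - 1) ^+ (n - r) * (euler_num r)%:~R.

Lemma size_euler_seq n : size (euler_seq n) = n.+1.
Proof. by elim: n => //= n IHn; rewrite size_rcons IHn. Qed.

Lemma nth_euler_seq n i : (i <= n)%N -> (euler_seq n)`_i = euler_num i.
Proof.
elim: n => [|n IHn]; first by rewrite leqn0 => /eqP->.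
rewrite leq_eqVlt => /predU1P[-> //|lt_in].
by rewrite /= nth_rcons size_euler_seq lt_in IHn.
Qed.

Lemma euler_num0 : euler_num 0 = 1.
Proof. by []. Qed.

Lemma euler_numS n : (0 < n)%N ->
  euler_num n =
    - \sum_(1 <= k < (n./2).+1) ('C(n, k.*2))%:R * euler_num (n - k.*2).
Proof.
case: n => // n _.
rewrite {1}/euler_num [euler_seq n.+1]/= nth_rcons size_euler_seq ltnn eqxx.
congr (- _); apply: eq_big_nat => -[//|k] _.
by rewrite nth_euler_seq // doubleS subSS leq_subLR leq_addl.
Qed.

Lemma pintegral_frac p (n d : int) :
  prime p -> ~~ (p %| `|d|)%N -> n%:~R / d%:~R \in pintegral p.
Proof.
move=> p_pr pNd; rewrite /pintegral unfold_in.
have d0 : d != 0 by apply: contraNneq pNd => ->; rewrite dvdn0.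
apply: contra pNd => /dvdn_trans; apply.
set x := _ / _.
have xE : x * d%:~R = n%:~R by rewrite /x divfK // intr_eq0.
have E : numq x * d = n * denq x.
  apply: (@intr_inj rat); rewrite !intrM -xE mulrAC; congr (_ * _).
  exact: numqE.
have : (`|denq x| %| `|numq x| * `|d|)%N.
  by rewrite -abszM E abszM dvdn_mull.
by rewrite Gauss_dvdr // coprime_sym coprime_num_den.
Qed.

Lemma pcong_presidue p a : prime p -> a \in pintegral p ->
  (presidue p a < p)%N /\ pcong p 1 a (presidue p a)%:R.
Proof.
move=> p_pr aZ; set P := fun r : nat => pcong p 1 a r%:R.
suff hasP_iota : has P (iota 0 p).
  have lt_p : (presidue p a < p)%N.
    by move: hasP_iota; rewrite has_find size_iota.
  split=> //; have := nth_find 0%N hasP_iota.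
  by rewrite nth_iota.
have p0 : (p%:Z : int) != 0 by rewrite -lt0n prime_gt0.
have cop : coprimez (denq a) p%:Z.
  by rewrite coprimezE coprime_sym prime_coprime.
have [[u v] /= uv] := coprimezP _ _ cop.
pose r := ((numq a * u) %% p%:Z)%Z.
have r0 : 0 <= r by rewrite modz_ge0.
have rp : r < p%:Z by rewrite ltz_pmod // ltz_nat prime_gt0.
have [r' rE] : exists r' : nat, r = r' by exists `|r|%N; rewrite gez0_abs.
rewrite rE ltz_nat in rp.
apply/hasP; exists r'; first by rewrite mem_iota.
rewrite /P /pcong expn1.
pose q := ((numq a * u) %/ p%:Z)%Z.
have dE : numq a * u = q * p%:Z + r' by rewrite -rE -divz_eq.
have d0 : (denq a)%:~R != 0 :> rat by rewrite intr_eq0 denq_eq0.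
have pr0 : p%:R != 0 :> rat by rewrite pnatr_eq0 -lt0n prime_gt0.
have nE : numq a - r'%:Z * denq a = p%:Z * (numq a * v + q * denq a).
  have -> : r'%:Z = numq a * u - q * p%:Z by rewrite dE addrC addKr.
  by rewrite -{1}[numq a]mulr1 -uv; ring.
have -> : (a - r'%:R) / p%:R = (numq a * v + q * denq a)%:~R / (denq a)%:~R.
  apply: (canRL (mulfK d0)); rewrite mulrAC; apply: (canLR (mulfK pr0)).
  rewrite mulrBl -numqE.
  by rewrite (pmulrn 1 p) (pmulrn 1 r') -!intrM -intrB nE mulrC.
exact: pintegral_frac.
Qed.

(* Main.v *)
Require Import Defs.
From HB Require Import structures.
From mathcomp Require Import all_boot all_order all_algebra ring zify.
Set Implicit Arguments.
Unset Strict Implicit.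
Unset Printing Implicit Defensive.
Import Order.TTheory GRing.Theory Num.Theory.
Local Open Scope ring_scope.

(* Write p = 2 m + 1 and S(a) for the sum. Termwise,
     a ((2 a - 1) S(a) - (2 a + 1) S(a - 1)) = 2 V(a),
   where V(a) = a * sum_(k <= m) binom(a, k) binom(-a, k) has the closed form
   a binom(a - 1, m) binom(- a - 1, m), which is edge a m below. Thus
   V(x) = x mod p^2 for p | x, and V(a + 1) = V(a) (a + m + 1) / (a - m) propagates this to
   V(j + x) = x mod p^2 for j <= m. Hence S(j + x) satisfies mod p^2 a first
   order recurrence in j, which is matched against
   E_{p-2}(y) + E_{p-2}(y + 1) = 2 y^(p-2), where y^(p-1) = 1 mod p. At j = 0
   both sides reduce to the alternating sum of the 1 / i with 0 < i < p. The
   case <a>_p > p / 2 follows from the symmetries S(-1 - a) = S(a) and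
   E_n(1 - y) = (-1)^n E_n(y). *)

(** * Identities over the rationals for the binomial sum *)

Lemma gbinomS x k : gbinom x k.+1 = gbinom x k * ((x - k%:R) / k.+1%:R).
Proof.
by rewrite /gbinom big_ord_recr factS natrM invfM /=; ring.
Qed.

Lemma gbinom0 x : gbinom x 0 = 1.
Proof. by rewrite /gbinom big_ord0 divr1. Qed.

(** Both sides are x (x - 1) ... (x - k) / k!. *)
Lemma gbinom_pred x k : x * gbinom (x - 1) k = (x - k%:R) * gbinom x k.
Proof.
elim: k => [|k IHk]; first by rewrite !gbinom0 subr0.
rewrite !gbinomS [LHS]mulrA IHk -(natr1 k).
ring.
Qed.

Definition trunc_sum m a :=
  \sum_(0 <= k < m.+1) gbinom a k * gbinom (-1 - a) k * (1 / (2%:R * k%:R - 1)).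

Definition edge a m := a * gbinom (a - 1) m * gbinom (- a - 1) m.

(** Telescoping: going from m to m + 1 multiplies [edge a m] by 1 - a^2 / (m + 1)^2, and a times the
    new summand is -a^2 / (m + 1)^2 times [edge a m]. *)
Lemma sum_gbinom_opp a m :
  a * (\sum_(0 <= k < m.+1) gbinom a k * gbinom (- a) k) = edge a m.
Proof.
rewrite /edge; elim: m => [|m IHm]; first by rewrite big_nat1 !gbinom0 !mulr1.
rewrite big_nat_recr //= mulrDr IHm !gbinomS -(natr1 m).
have e1 := gbinom_pred a m; have e2 := gbinom_pred (- a) m.
have m0 : m%:R + 1 != 0 :> rat by rewrite natr1 pnatr_eq0.
transitivity (a * gbinom (a - 1) m * gbinom (- a - 1) m +
  (a * ((a - m%:R) * gbinom a m) * ((- a - m%:R) * gbinom (- a) m))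
    / (m%:R + 1) ^+ 2).
  by field.
by rewrite -e1 -e2; field.
Qed.

Lemma double_pred_neq0 k : 2%:R * k%:R - 1 != 0 :> rat.
Proof.
by rewrite -natrM subr_eq0 (eqr_nat _ _ 1); case: k => // k; rewrite mulnS.
Qed.

(** In terms of binom(a, k) binom(-a, k), the k-th terms of the two sums carry the factors a + k and
    a - k, and (2 a - 1) (a + k) - (2 a + 1) (a - k) = 2 a (2 k - 1) cancels the denominator. *)
Lemma trunc_sum_step m a :
  a * ((2%:R * a - 1) * trunc_sum m a) =
  a * ((2%:R * a + 1) * trunc_sum m (a - 1)) + 2%:R * edge a m.
Proof.
rewrite -sum_gbinom_opp /trunc_sum !mulr_sumr -big_split /=.
apply: eq_bigr => k _.
have -> : -1 - (a - 1) = - a by ring.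
have -> : -1 - a = - a - 1 by ring.
have e1 := gbinom_pred a k; have e2 := gbinom_pred (- a) k.
have k0 := double_pred_neq0 k.
transitivity ((- (2%:R * a - 1) * gbinom a k * ((- a) * gbinom (- a - 1) k))
  / (2%:R * k%:R - 1)).
  by field.
rewrite e2.
transitivity ((2%:R * a + 1) * gbinom (- a) k * (a * gbinom (a - 1) k)
    / (2%:R * k%:R - 1) +
  2%:R * (a * (gbinom a k * gbinom (- a) k))); last by field.
by rewrite e1; field.
Qed.

Lemma trunc_sum_compl m a : trunc_sum m (-1 - a) = trunc_sum m a.
Proof.
apply: eq_bigr => k _; have -> : -1 - (-1 - a) = a by ring.
by rewrite [gbinom a k * _]mulrC.
Qed.

Lemma edgeS a m : (a - m%:R) * edge (a + 1) m = (a + m%:R + 1) * edge a m.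
Proof.
rewrite /edge addrK.
have -> : - (a + 1) = - a - 1 by ring.
have e1 := gbinom_pred a m; have e2 := gbinom_pred (- a - 1) m.
transitivity (- ((a - m%:R) * gbinom a m)
  * ((- a - 1) * gbinom (- a - 1 - 1) m)).
  by ring.
by rewrite e2 -e1; ring.
Qed.

(** * Euler numbers and Euler polynomials, by umbral calculus *)

Lemma euler_num_odd n : odd n -> euler_num n = 0.
Proof.
elim/ltn_ind: n => n IHn odd_n; have n0 : (0 < n)%N by case: n odd_n {IHn}.
rewrite euler_numS // big_nat big1 ?oppr0 // => k /andP[k0 _].
have [le_kn|lt_nk] := leqP k.*2 n; last by rewrite bin_small // mul0r.
rewrite IHn ?mulr0 //; last by rewrite oddB // odd_double addbF.
by rewrite ltn_subrL n0 double_gt0 k0.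
Qed.

(* The linear functional X^r |-> E_r, which sends (X + 2 x - 1)^n to
   2^n E_n(x). *)
Definition umbra (q : {poly rat}) : rat :=
  \sum_(r < size q) q`_r * (euler_num r)%:~R.

Lemma umbra_widen n (q : {poly rat}) : (size q <= n)%N ->
  umbra q = \sum_(r < n) q`_r * (euler_num r)%:~R.
Proof.
move=> le_qn; rewrite /umbra.
rewrite (big_ord_widen _ (fun r => q`_r * (euler_num r)%:~R) le_qn).
rewrite big_mkcond; apply: eq_bigr => r _; case: ltnP => // le_qr.
by rewrite nth_default // mul0r.
Qed.

Lemma umbraD q s : umbra (q + s) = umbra q + umbra s.
Proof.
set n := maxn (size q) (size s).
rewrite (@umbra_widen n (q + s)) ?(@umbra_widen n q) ?(@umbra_widen n s)
  ?leq_maxl ?leq_maxr //.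
  by rewrite -big_split; apply: eq_bigr => r _; rewrite coefD mulrDl.
exact: size_polyD.
Qed.

Lemma umbraZ c q : umbra (c *: q) = c * umbra q.
Proof.
rewrite (@umbra_widen (size q) (c *: q)) ?size_scale_leq // mulr_sumr.
by apply: eq_bigr => r _; rewrite coefZ mulrA.
Qed.

Lemma umbra0 : umbra 0 = 0.
Proof. by rewrite /umbra size_poly0 big_ord0. Qed.

Lemma umbra_sum (I : Type) (s : seq I) (P : pred I) F :
  umbra (\sum_(i <- s | P i) F i) = \sum_(i <- s | P i) umbra (F i).
Proof. exact: (big_morph umbra umbraD umbra0). Qed.

Lemma umbraXn n : umbra 'X^n = (euler_num n)%:~R.
Proof.
rewrite (@umbra_widen n.+1) ?size_polyXn // big_ord_recr /= big1.
  by rewrite coefXn eqxx mul1r add0r.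
by move=> i _; rewrite coefXn ltn_eqF // mul0r.
Qed.

Lemma umbraXnD n c :
  umbra (('X + c%:P) ^+ n) =
  \sum_(r < n.+1) 'C(n, r)%:R * c ^+ (n - r) * (euler_num r)%:~R.
Proof.
rewrite addrC exprDn umbra_sum; apply: eq_bigr => i _.
rewrite -polyC_exp mul_polyC -scaler_nat scalerA umbraZ umbraXn //.
Qed.

Lemma euler_polyE n x :
  euler_poly n x = 2%:R ^- n * umbra (('X + (2%:R * x - 1)%:P) ^+ n).
Proof. by rewrite umbraXnD. Qed.


(** Even indices are the ones left when (X + 1)^n and (X - 1)^n are added; [uphalf n] counts the
    even j < n. *)
Lemma sum_even (F : nat -> rat) n :
  \sum_(0 <= j < n) (~~ odd j)%:R * F j = \sum_(0 <= k < uphalf n) F k.*2.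
Proof.
elim: n => [|n IHn]; first by rewrite !big_nil.
rewrite big_nat_recr //= IHn uphalf_half.
case: (boolP (odd n)) => odd_n /=; first by rewrite mul0r addr0.
by rewrite add0n big_nat_recr //= mul1r even_halfK.
Qed.

(** For n > 0 this is the recursion of the Euler numbers, doubled. *)
Lemma umbra_shift_Xn n :
  umbra (('X + 1) ^+ n + ('X - 1) ^+ n) = (n == 0)%:R *+ 2.
Proof.
case: n => [|n]; first by rewrite !expr0 umbraD -(expr0 'X) umbraXn.
rewrite umbraD -polyC1 -polyCN !umbraXnD -big_split /=.
rewrite -(big_mkord xpredT (fun r => 'C(n.+1, r)%:R * 1 ^+ (n.+1 - r) *
  (euler_num r)%:~R + 'C(n.+1, r)%:R * (-1) ^+ (n.+1 - r) *
  (euler_num r)%:~R : rat)) big_nat_rev /= add0n.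
have := euler_numS (ltn0Sn n).
move/(congr1 (fun z : int => z%:~R : rat)).
set N := n.+1; rewrite rmorphN rmorph_sum => /eqP; rewrite -addr_eq0 => /eqP E0.
(* After the reversal j is the exponent of 1 and of -1, and 1 + (-1)^j is 2 or 0. *)
transitivity (2%:R * \sum_(0 <= j < N.+1)
    (~~ odd j)%:R * ('C(N, j)%:R * (euler_num (N - j))%:~R) : rat).
  rewrite mulr_sumr; apply: eq_big_nat => j /andP[_]; rewrite ltnS => le_jN.
  rewrite subSS bin_sub // subKn // expr1n -signr_odd.
  by case: (odd j) => /=; ring.
rewrite sum_even /= big_nat_recl // bin0 subn0 mul1r.
rewrite mul0rn; apply: (etrans _ (mulr0 2%:R)); congr (_ * _); rewrite -[RHS]E0.
rewrite big_add1 /=; congr (_ + _); apply: eq_bigr => k _.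
by rewrite rmorphM rmorph_nat.
Qed.

Lemma umbra_shift (q : {poly rat}) :
  umbra ((q \Po ('X + 1)) + (q \Po ('X - 1))) = q`_0 *+ 2.
Proof.
rewrite !comp_polyE umbraD !umbra_sum -big_split /=.
under eq_bigr => i _ do rewrite !umbraZ -mulrDr -umbraD umbra_shift_Xn.
case: (posnP (size q)) => [q0|q0].
  by rewrite q0 big_ord0 nth_default ?q0 // mul0rn.
rewrite (bigD1 (Ordinal q0)) //= big1 ?addr0; first by rewrite mulrnAr mulr1.
move=> [[|i] lt_i] // _.
by rewrite mul0rn mulr0.
Qed.

(** Take q = (X + 2 x)^n in [umbra_shift]: q(X - 1) and q(X + 1) are sent to 2^n E_n(x) and 2^n
    E_n(x + 1), and q(0) = (2 x)^n. *)
Lemma euler_poly_shift n x :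
  euler_poly n x + euler_poly n (x + 1) = 2%:R * x ^+ n.
Proof.
rewrite !euler_polyE -mulrDr -umbraD.
have shiftE c :
    ('X + (2%:R * x)%:P) ^+ n \Po ('X + c%:P) = ('X + (2%:R * x + c)%:P) ^+ n.
  by rewrite rmorphXn /= comp_polyD comp_polyX comp_polyC polyCD addrAC addrA.
have := umbra_shift (('X + (2%:R * x)%:P) ^+ n).
rewrite -polyC1 -polyCN !shiftE addrC.
rewrite (_ : 2%:R * (x + 1) - 1 = 2%:R * x + 1); last by ring.
rewrite addrC => ->.
rewrite -horner_coef0 horner_exp !hornerE exprMn.
by rewrite mulrnAr mulKf ?expf_neq0 // mulr_natl.
Qed.

(** Only even r contribute, and for these (-1)^(n - r) = (-1)^n. *)
Lemma euler_poly_compl n x : euler_poly n (1 - x) = (-1) ^+ n * euler_poly n x.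
Proof.
rewrite /euler_poly mulrCA; congr (_ * _); rewrite mulr_sumr.
apply: eq_bigr => -[r /=]; rewrite ltnS => le_rn _.
have [odd_r|even_r] := boolP (odd r); first by rewrite euler_num_odd // !mulr0.
have -> : 2%:R * (1 - x) - 1 = - (2%:R * x - 1) by ring.
rewrite [(- (_ - _)) ^+ _]exprNn.
have -> : (-1) ^+ (n - r) = (-1) ^+ n :> rat.
  by rewrite -signr_odd oddB // (negbTE even_r) addbF signr_odd.
ring.
Qed.

(** * Arithmetic in Z_(p) and congruences modulo p^n *)

Section Localization.
Variables (p : nat) (p_pr : prime p).
Implicit Types (x y z c : rat) (n k : nat).

(** The product of the two denominators is a common denominator still prime to p. *)
Lemma pintegral_subring : subring_closed (pintegral p).
Proof.
have fracE x y : x \in pintegral p -> y \in pintegral p ->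
    [/\ denq x != 0, denq y != 0 &
        let d := denq x * denq y in ~~ (p %| `|d|)%N].
  rewrite /pintegral !unfold_in => xZ yZ.
  by rewrite /= !denq_eq0 abszM Euclid_dvdM // negb_or xZ yZ.
split=> [|x y xZ yZ|x y xZ yZ].
- rewrite -[1]divr1 (@pintegral_frac p 1 1) //= dvdn1.
  by rewrite neq_ltn prime_gt1 ?orbT.
- have [x0 y0 xy] := fracE x y xZ yZ.
  have -> : x - y =
      (numq x * denq y - numq y * denq x)%:~R / (denq x * denq y)%:~R.
    rewrite -{1}[x]divq_num_den -{1}[y]divq_num_den rmorphB !rmorphM /=.
    by field; rewrite !intr_eq0 x0 y0.
  exact: pintegral_frac.
have [x0 y0 xy] := fracE x y xZ yZ.
have -> : x * y = (numq x * numq y)%:~R / (denq x * denq y)%:~R.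
  rewrite -{1}[x]divq_num_den -{1}[y]divq_num_den !rmorphM /=.
  by field; rewrite !intr_eq0 x0 y0.
exact: pintegral_frac.
Qed.

HB.instance Definition _ :=
  GRing.isSubringClosed.Build rat (pintegral p) pintegral_subring.

Lemma natr_prime_neq0 : p%:R != 0 :> rat.
Proof. by rewrite pnatr_eq0 -lt0n prime_gt0. Qed.

Lemma pcongP n x y :
  reflect (exists2 z, z \in pintegral p & x = y + p%:R ^+ n * z)
          (pcong p n x y).
Proof.
have pn0 : (p ^ n)%:R != 0 :> rat by rewrite natrX expf_neq0 ?natr_prime_neq0.
rewrite /pcong; apply: (iffP idP) => [xyZ|[z zZ ->]].
  exists ((x - y) / (p ^ n)%:R); first by [].
  by rewrite -natrX mulrC divfK // addrC subrK.
by rewrite -natrX addrC addKr mulrC mulKf.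
Qed.

Lemma pcong_refl n x : pcong p n x x.
Proof. by rewrite /pcong subrr mul0r rpred0. Qed.

Lemma pcong_sym n x y : pcong p n x y -> pcong p n y x.
Proof. by rewrite /pcong -[y - x]opprB mulNr rpredN. Qed.

Lemma pcong_trans n y x z : pcong p n x y -> pcong p n y z -> pcong p n x z.
Proof.
by rewrite /pcong => xy /(rpredD xy); rewrite -mulrDl addrA subrK.
Qed.

Lemma pcong_pintegral n x y :
  pcong p n x y -> y \in pintegral p -> x \in pintegral p.
Proof.
by case/pcongP=> z zZ -> yZ; rewrite rpredD ?rpredM ?rpredX ?rpred_nat.
Qed.

Lemma pcongD n x y z t :
  pcong p n x y -> pcong p n z t -> pcong p n (x + z) (y + t).
Proof.
move=> /pcongP[u uZ ->] /pcongP[v vZ ->]; apply/pcongP.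
by exists (u + v); [rewrite rpredD | ring].
Qed.

Lemma pcong_addr0 n c x : pcong p n x 0 -> pcong p n (c + x) c.
Proof. by rewrite /pcong subr0 [c + x]addrC addrK. Qed.

Lemma pcongN n x y : pcong p n x y -> pcong p n (- x) (- y).
Proof. by rewrite /pcong -opprD mulNr rpredN. Qed.

Lemma pcong_sum n (I : Type) (s : seq I) (P : pred I) (F G : I -> rat) :
  (forall i, P i -> pcong p n (F i) (G i)) ->
  pcong p n (\sum_(i <- s | P i) F i) (\sum_(i <- s | P i) G i).
Proof.
move=> FG; elim/big_rec2: _ => [|i y x Pi]; first exact: pcong_refl.
exact/pcongD/FG.
Qed.

Lemma pcongM n x y z t : x \in pintegral p -> t \in pintegral p ->
  pcong p n x y -> pcong p n z t -> pcong p n (x * z) (y * t).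
Proof.
move=> xZ tZ /pcongP[u uZ xE] /pcongP[v vZ ->]; apply/pcongP.
by exists (u * t + x * v); [rewrite rpredD // rpredM | rewrite xE; ring].
Qed.

Lemma pcongMl n c x y :
  c \in pintegral p -> pcong p n x y -> pcong p n (c * x) (c * y).
Proof. by rewrite /pcong -mulrBr -mulrA; apply: rpredM. Qed.

Lemma pcongX n k x y : x \in pintegral p -> y \in pintegral p ->
  pcong p n x y -> pcong p n (x ^+ k) (y ^+ k).
Proof.
move=> xZ yZ xy; elim: k => [|k IHk]; first exact: pcong_refl.
by rewrite !exprS pcongM ?rpredX.
Qed.

(** A common factor divisible by p gains one power of p. Thanks to this, Euler polynomials and
    Fermat powers are only ever needed modulo p. *)
Lemma pcongS_mul n c x y :
  pcong p 1 c 0 -> pcong p n x y -> pcong p n.+1 (c * x) (c * y).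
Proof.
move=> /pcongP[u uZ ->] /pcongP[v vZ ->]; apply/pcongP.
by exists (u * v); [rewrite rpredM | rewrite add0r expr1 exprS; ring].
Qed.

Lemma pcong1_nat k : pcong p 1 k%:R 0 = (p %| k)%N.
Proof.
apply/pcongP/idP=> [[z zZ]|/dvdnP[q ->]]; last first.
  by exists q%:R; rewrite ?rpred_nat // natrM; ring.
rewrite add0r expr1 => kE.
have kdE : Posz k * denq z = Posz p * numq z.
  by apply: (@intr_inj rat); rewrite !intrM numqE mulrA -!pmulrn kE.
have : (p %| k * `|denq z|)%N.
  by rewrite -[X in (_ %| X * _)%N]absz_nat -abszM kdE abszM dvdn_mulr.
by rewrite Euclid_dvdM // => /orP[//|pz]; move: zZ; rewrite unfold_in pz.
Qed.

Lemma pintegral_inv c :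
  c \in pintegral p -> ~~ pcong p 1 c 0 -> c^-1 \in pintegral p.
Proof.
move=> cZ; rewrite -{2}[c]divq_num_den invf_div => c0.
apply: pintegral_frac => //; apply: contra c0 => /dvdnP[q qE].
(* As the numerator of c is q p up to sign, this witness is c / p. *)
apply/pcongP; exists ((-1) ^+ (numq c < 0)%R * q%:R / (denq c)%:~R).
  rewrite -mulrA rpredM ?rpredX ?rpredN ?rpred1 //.
  by apply: (@pintegral_frac p q%:Z); rewrite // -unfold_in.
rewrite add0r expr1 -{1}[c]divq_num_den [numq c in LHS]intEsign qE.
by rewrite rmorphM rmorph_sign /= -pmulrn natrM; ring.
Qed.

Lemma pcong_cancel n c x y : c \in pintegral p -> ~~ pcong p 1 c 0 ->
  pcong p n (c * x) (c * y) -> pcong p n x y.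
Proof.
move=> cZ c0; have cVZ := pintegral_inv cZ c0.
have cn0 : c != 0 by apply: contraNneq c0 => ->; apply: pcong_refl.
by move=> /(pcongMl cVZ); rewrite !mulKf.
Qed.

Lemma pintegral_natV k : (0 < k < p)%N -> k%:R^-1 \in pintegral p.
Proof.
case/andP=> k0 kp; rewrite pintegral_inv ?rpred_nat //.
by rewrite pcong1_nat; apply: contraL kp => /(dvdn_leq k0); rewrite leqNgt.
Qed.

(** Fermat's r^p = r for the integer residue r of c gives c^p = c modulo p, and the unit c
    cancels. *)
Lemma pintegral_fermat c : c \in pintegral p -> ~~ pcong p 1 c 0 ->
  pcong p 1 (c ^+ p.-1) 1.
Proof.
move=> cZ c0; have [_ cr] := pcong_presidue p_pr cZ.
apply: (pcong_cancel cZ c0); rewrite -exprS prednK ?prime_gt0 // mulr1.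
apply: (pcong_trans (pcongX p cZ (rpred_nat _ _) cr)).
apply: pcong_trans (pcong_sym cr).
have := fermat_little (presidue p c) p_pr.
(* Natural subtraction requires r <= r^p, which is checked twice. *)
move: (presidue p c) => r /eqP; rewrite eqn_mod_dvd; last first.
  by case: r => // r; rewrite -{1}[r.+1]expn1 leq_pexp2l // prime_gt0.
rewrite -pcong1_nat natrB ?natrX; last first.
  by case: r => // r; rewrite -{1}[r.+1]expn1 leq_pexp2l // prime_gt0.
by move=> /pcongD-/(_ _ _ (pcong_refl 1 r%:R)); rewrite subrK add0r.
Qed.

(** * Euler polynomials modulo an odd prime p = 2 m + 1 *)

Variables (m : nat) (pE : p = m.*2.+1).

Lemma pintegral_half : 2%:R^-1 \in pintegral p.
Proof. by have p_gt1 := prime_gt1 p_pr; apply: pintegral_natV; lia. Qed.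

(** The only denominator is a power of 2, a unit because p is odd. *)
Lemma pintegral_euler_poly n x :
  x \in pintegral p -> euler_poly n x \in pintegral p.
Proof.
move=> xZ; rewrite /euler_poly -exprVn rpredM ?rpredX ?pintegral_half //.
apply: rpred_sum => r _.
rewrite !rpredM ?rpredX ?rpred_nat ?rpred_int //.
by rewrite rpredB ?rpredM ?rpred_nat ?rpred1.
Qed.

Lemma pcong_euler_poly n x y : x \in pintegral p -> y \in pintegral p ->
  pcong p 1 x y -> pcong p 1 (euler_poly n x) (euler_poly n y).
Proof.
move=> xZ yZ xy; rewrite /euler_poly -exprVn.
apply: pcongMl; first by rewrite rpredX ?pintegral_half.
apply: pcong_sum => r _; rewrite ![_ * (euler_num r)%:~R]mulrC.
apply: pcongMl; first exact: rpred_int.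
apply: pcongMl; first exact: rpred_nat.
apply: pcongX; rewrite ?rpredB ?rpredM ?rpred_nat ?rpred1 //.
by apply: pcongD; rewrite ?pcong_refl ?pcongMl ?rpred_nat.
Qed.

(** * The closed form [edge] modulo p^2 *)

Lemma pcong0_pintegral x : pcong p 1 x 0 -> x \in pintegral p.
Proof. by move=> x0; apply: (pcong_pintegral x0); apply: rpred0. Qed.

(* edge x m is x times the product of the 1 - x^2 / i^2 for 0 < i <= m. *)
Lemma edge_pcong0 x : pcong p 1 x 0 -> pcong p 2 (edge x m) x.
Proof.
move=> x0; have xZ := pcong0_pintegral x0.
(* The factor x supplies one power of p, so the cofactor is needed only modulo p. *)
rewrite /edge -mulrA -[X in pcong _ _ _ X]mulr1; apply: pcongS_mul => //.
pose g k := gbinom (x - 1) k * gbinom (- x - 1) k.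
suff gP k : (k <= m)%N -> pcong p 1 (g k) 1 /\ g k \in pintegral p.
  by case: (gP m).
rewrite /g; elim: k => [|k IHk] le_km.
  by rewrite !gbinom0 mulr1 pcong_refl rpred1.
have [IH IHZ] := IHk (ltnW le_km).
have kV : k.+1%:R^-1 \in pintegral p by rewrite pintegral_natV //; lia.
have k0 : k.+1%:R != 0 :> rat by rewrite pnatr_eq0.
rewrite !gbinomS (_ : _ * _ * _ = (gbinom (x - 1) k * gbinom (- x - 1) k) *
  (1 - x * (x * k.+1%:R^-1 ^+ 2))); last first.
  by rewrite -(natr1 k) in k0 *; field.
have fZ : 1 - x * (x * k.+1%:R^-1 ^+ 2) \in pintegral p.
  by rewrite rpredB ?rpred1 ?rpredM ?rpredX.
split; last by rewrite rpredM.
rewrite -[X in pcong _ _ _ X]mulr1; apply: pcongM; rewrite ?rpred1 //.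
case/pcongP: x0 => u uZ xE; apply/pcongP.
exists (- u * (x * k.+1%:R^-1 ^+ 2)).
  by rewrite rpredM ?rpredN ?rpredM ?rpredX.
by rewrite {1}xE; ring.
Qed.

Lemma pcong_unit j x : pcong p 1 x j%:R -> ~~ (p %| j)%N -> ~~ pcong p 1 x 0.
Proof.
move=> xj; apply: contra => x0; rewrite -pcong1_nat.
exact: pcong_trans (pcong_sym xj) x0.
Qed.

(** With a = j + x, [edgeS] and p = 2 m + 1 give (m - a) V(a + 1) = (m - a) V(a) - p V(a). The last
    term vanishes modulo p^2 because V(a) = x = 0 modulo p, and m - a is a unit as long as j < m. *)
Lemma edge_pcong j x : pcong p 1 x 0 -> (j <= m)%N ->
  pcong p 2 (edge (j%:R + x) m) x.
Proof.
move=> x0; have xZ := pcong0_pintegral x0.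
elim: j => [|j IHj] lt_jm; first by rewrite add0r edge_pcong0.
have IH := IHj (ltnW lt_jm).
have aZ : m%:R - (j%:R + x) \in pintegral p.
  by rewrite rpredB ?rpredD ?rpred_nat.
apply: (@pcong_cancel 2 (m%:R - (j%:R + x))) => //.
  apply: (@pcong_unit (m - j)).
    rewrite natrB 1?ltnW // opprD addrA; apply: pcong_addr0.
    by rewrite -oppr0; apply: pcongN.
  by rewrite gtnNdvd ?subn_gt0 // pE; lia.
have -> : j.+1%:R + x = j%:R + x + 1 by rewrite -natr1; ring.
have -> : (m%:R - (j%:R + x)) * edge (j%:R + x + 1) m =
    (m%:R - (j%:R + x)) * edge (j%:R + x) m - p%:R * edge (j%:R + x) m.
  have -> : p%:R = m%:R + m%:R + 1 :> rat by rewrite pE -addnn -natr1 natrD.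
  by rewrite -opprB mulNr edgeS; ring.
apply: pcong_trans (pcongMl aZ IH); apply: pcong_addr0.
rewrite -oppr0 -(mulr0 p%:R); apply/pcongN/pcongS_mul.
  by rewrite pcong1_nat.
apply: (pcong_trans _ x0).
case/pcongP: IH => u uZ ->; apply/pcongP.
by exists (p%:R * u); [rewrite rpredM ?rpred_nat | ring].
Qed.

(** * The sum when p divides a *)

Lemma pcong_inv_fermat j : (j < p)%N -> pcong p 1 (j%:R ^+ (p - 2)) j%:R^-1.
Proof.
move=> lt_jp; have p_gt1 := prime_gt1 p_pr.
case: (posnP j) => [->|j0].
  (* Both sides are 0 here: the exponent is positive and 0^-1 = 0. *)
  have -> : (p - 2 = (p - 3).+1)%N by lia.
  by rewrite invr0 expr0n; apply: pcong_refl.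
have jN : ~~ pcong p 1 j%:R 0 by rewrite pcong1_nat gtnNdvd.
apply: (@pcong_cancel 1 j%:R); rewrite ?rpred_nat //.
rewrite -exprS mulfV ?pnatr_eq0 -?lt0n //.
have -> : (p - 2).+1 = p.-1 by lia.
by apply: pintegral_fermat; rewrite ?rpred_nat.
Qed.

(** By 1 / (k (2 k - 1)) = 2 / (2 k - 1) - 2 / (2 k), the right side is the sum of 2 (-1)^j / j over
    j < p, the terms at 0 vanishing since 0^-1 = 0. With j^(p-2) for 1 / j it telescopes by
    [euler_poly_shift]. *)
Lemma pcong_euler_poly0 :
  pcong p 1 (2%:R * euler_poly (p - 2) 0)
            (- \sum_(0 <= k < m.+1) k%:R^-1 / (2%:R * k%:R - 1)).
Proof.
have -> : - (\sum_(0 <= k < m.+1) k%:R^-1 / (2%:R * k%:R - 1)) =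
    \sum_(0 <= j < p) 2%:R * (-1) ^+ j * j%:R^-1 :> rat.
  rewrite pE; elim: {+}m => [|n IHn].
    by rewrite !big_nat1 /= invr0 mul0r mulr0 oppr0.
  have n0 : n.+1%:R != 0 :> rat by rewrite pnatr_eq0.
  have k0 := double_pred_neq0 n.+1.
  rewrite big_nat_recr //= opprD IHn doubleS [RHS]big_nat_recr //=.
  rewrite [X in _ = X + _]big_nat_recr //=.
  rewrite !exprS -mul2n exprM sqrrN !expr1n -addrA; congr (_ + _).
  have -> : (2 * n).+1%:R = 2%:R * n.+1%:R - 1 :> rat.
    by rewrite -natrM mulnS -(natr1 (2 * n).+1) addrK.
  have -> : (2 * n).+2%:R = 2%:R * n.+1%:R :> rat by rewrite -natrM mulnS.
  by move: n.+1%:R n0 k0 => c n0 k0; field; rewrite n0 k0.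
apply: (@pcong_trans _ (\sum_(0 <= j < p) 2%:R * (-1) ^+ j * j%:R ^+ (p - 2))).
  have eE n : \sum_(0 <= j < n) 2%:R * (-1) ^+ j * j%:R ^+ (p - 2) =
      euler_poly (p - 2) 0 - (-1) ^+ n * euler_poly (p - 2) n%:R.
    elim: n => [|n IHn]; first by rewrite big_nil expr0 mul1r subrr.
    rewrite big_nat_recr //= IHn -(natr1 n) exprS.
    have := euler_poly_shift (p - 2) n%:R.
    move=> /(canRL (addrK _)) ->.
    ring.
  have -> : 2%:R * euler_poly (p - 2) 0 =
      euler_poly (p - 2) 0 + euler_poly (p - 2) 0 by ring.
  (* As p is odd, the endpoints add up to E_{p-2}(0) + E_{p-2}(p), and p = 0 modulo p. *)
  have sgn_p : (-1) ^+ p = -1 :> rat by rewrite -signr_odd pE /= odd_double.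
  rewrite eE sgn_p mulN1r opprK.
  apply: pcongD; first exact: pcong_refl.
  apply: pcong_euler_poly; rewrite ?rpred0 ?rpred_nat //.
  by apply: pcong_sym; rewrite pcong1_nat.
rewrite !big_nat; apply: pcong_sum => j lt_jp.
apply: pcongMl; last exact: pcong_inv_fermat.
by rewrite rpredM ?rpred_nat // rpredX // rpredN1.
Qed.

(** The ratio of the terms k + 1 and k is k / (k + 1) modulo p. This suffices modulo p^2 because the
    terms themselves are divisible by p. *)
Lemma pcong_gbinom_mul x k : pcong p 1 x 0 -> (0 < k <= m)%N ->
  pcong p 2 (gbinom x k * gbinom (-1 - x) k) (- x * k%:R^-1).
Proof.
move=> x0; have xZ := pcong0_pintegral x0.
case: k => // k; elim: k => [|k IHk] le_km.
  rewrite !gbinomS !gbinom0 !subr0 invr1 !mulr1 !mul1r.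
  have -> : x * (-1 - x) = - x + - x * x by ring.
  apply: pcong_addr0; rewrite -(mulr0 (- x)); apply: pcongS_mul => //.
  by rewrite -oppr0; apply: pcongN.
have {IHk} IH := IHk (ltnW le_km).
have p_gt1 := prime_gt1 p_pr.
have kV : k.+2%:R^-1 \in pintegral p by rewrite pintegral_natV //; lia.
have k1V : k.+1%:R^-1 \in pintegral p by rewrite pintegral_natV //; lia.
have k0 : k.+2%:R != 0 :> rat by rewrite pnatr_eq0.
have k10 : k.+1%:R != 0 :> rat by rewrite pnatr_eq0.
(* The exact ratio of consecutive terms, with its multiple of x split off. *)
pose f := k.+1%:R * k.+2%:R^-1 + x * (- (x + 1) * k.+2%:R^-1 ^+ 2).
have fZ : f \in pintegral p.
  by rewrite rpredD ?rpredM ?rpredN ?rpredX ?rpred_nat // rpredD ?rpred1.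
rewrite gbinomS [gbinom (-1 - x) _]gbinomS.
have -> : gbinom x k.+1 * ((x - k.+1%:R) / k.+2%:R) *
   (gbinom (-1 - x) k.+1 * ((-1 - x - k.+1%:R) / k.+2%:R)) =
   f * (gbinom x k.+1 * gbinom (-1 - x) k.+1).
  rewrite /f; move: k0; rewrite -(natr1 k.+1).
  by move: k.+1%:R => c c0; field.
apply: pcong_trans (pcongMl fZ IH) _.
rewrite mulrC.
have -> : - x * k.+2%:R^-1 = - x * k.+1%:R^-1 * (k.+1%:R * k.+2%:R^-1).
  by rewrite mulrA mulfVK.
apply: pcongS_mul.
  by rewrite mulrC -(mulr0 k.+1%:R^-1) -oppr0; apply/pcongMl/pcongN.
apply: pcong_addr0; rewrite mulrC.
rewrite -[X in pcong _ _ _ X](mulr0 (- (x + 1) * k.+2%:R^-1 ^+ 2)).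
by apply: pcongMl; rewrite // rpredM ?rpredN ?rpredX // rpredD ?rpred1.
Qed.

Lemma trunc_sum_pcong0 x : pcong p 1 x 0 ->
  pcong p 2 (trunc_sum m x) (-1 + 2%:R * x * euler_poly (p - 2) 0).
Proof.
move=> x0.
rewrite [2%:R * x]mulrC -mulrA.
have e0 := pcongS_mul x0 (pcong_sym pcong_euler_poly0).
apply: pcong_trans (pcongD (pcong_refl _ _) e0).
(* The term k = 0 is -1 on the left, and 0 on the right because 0^-1 = 0. *)
rewrite /trunc_sum !(big_nat_recl m) // !gbinom0.
rewrite invr0 mul0r (_ : 1 * 1 * (1 / (2%:R * 0%:R - 1)) = -1) //.
apply: pcongD; first exact: pcong_refl.
rewrite add0r mulrN -mulNr mulr_sumr !big_nat; apply: pcong_sum => k /= lt_km.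
have -> : - x * (k.+1%:R^-1 / (2%:R * k.+1%:R - 1)) =
  (2%:R * k.+1%:R - 1)^-1 * (- x * k.+1%:R^-1) by ring.
rewrite div1r mulrC.
apply: pcongMl; last by apply: pcong_gbinom_mul.
have -> : 2%:R * k.+1%:R - 1 = (k.*2.+1)%:R :> rat.
  by rewrite -natrM mul2n doubleS -(natr1 k.*2.+1) addrK.
by apply: pintegral_natV; lia.
Qed.

(** * Residues j <= m, by induction on j *)

Lemma trunc_sum_pcong j a : pcong p 1 a j%:R -> (j <= m)%N ->
  pcong p 2 (trunc_sum m a)
    (- (2%:R * a + 1) + 2%:R * (a - j%:R) *
       (1 + (2%:R * a + 1) * euler_poly (p - 2) (- (2%:R * a)))).
Proof.
move=> aj; have [x aE] : exists x, a = j%:R + x.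
  by exists (a - j%:R); rewrite addrC subrK.
have x0 : pcong p 1 x 0.
  by move: aj; rewrite aE /pcong subr0 addrAC subrr add0r.
have xZ := pcong0_pintegral x0.
rewrite aE [_ + x - _]addrAC subrr add0r {a aj aE}; elim: j => [|j IHj] lt_jm.
  (* The factor 2 x leaves only (2 x + 1) E_{p-2}(-2 x) = E_{p-2}(0) modulo p to check. *)
  rewrite add0r; apply: pcong_trans (trunc_sum_pcong0 x0) _.
  set t := 1 + _ * _.
  have -> : - (2%:R * x + 1) + 2%:R * x * t = -1 + 2%:R * x * (t - 1) by ring.
  apply: pcongD; first exact: pcong_refl.
  have x20 : pcong p 1 (2%:R * x) 0.
    by rewrite -(mulr0 2%:R) pcongMl ?rpred_nat.
  have xN0 : pcong p 1 (- (2%:R * x)) 0 by rewrite -oppr0; apply: pcongN.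
  have xNZ := pcong0_pintegral xN0.
  apply: pcongS_mul => //; rewrite /t addrC addKr -[X in pcong _ _ X]mul1r.
  apply: pcongM; rewrite ?rpred1 ?pintegral_euler_poly //.
    by apply: pcong_sym; rewrite addrC; apply: pcong_addr0.
  by apply: pcong_sym; apply: pcong_euler_poly; rewrite ?rpred0.
have p_gt1 := prime_gt1 p_pr; set a := _ + x.
have aj : pcong p 1 a j.+1%:R by apply: pcong_addr0.
have aZ : a \in pintegral p by rewrite rpredD ?rpred_nat.
(* Since j + 1 <= m, both a = j + 1 and 2 a - 1 = 2 j + 1 are units modulo p, so the recurrence may
   be divided by them. *)
have aU : ~~ pcong p 1 a 0 by apply: pcong_unit aj _; rewrite gtnNdvd //; lia.
have bZ : 2%:R * a - 1 \in pintegral p.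
  by rewrite rpredB ?rpredM ?rpred_nat ?rpred1.
have bU : ~~ pcong p 1 (2%:R * a - 1) 0.
  apply: (@pcong_unit (j.*2.+1)); last by rewrite gtnNdvd //; lia.
  have -> : 2%:R * a - 1 = j.*2.+1%:R + 2%:R * x.
    by rewrite /a -(natr1 j) -(natr1 j.*2) -mul2n natrM; ring.
  by apply: pcong_addr0; rewrite -(mulr0 2%:R) pcongMl ?rpred_nat.
apply: (pcong_cancel aZ aU); apply: (pcong_cancel bZ bU).
rewrite [X in pcong _ _ X]mulrCA [X in pcong _ _ _ X]mulrCA trunc_sum_step.
have IH := IHj (ltnW lt_jm).
have -> : a - 1 = j%:R + x by rewrite /a -(natr1 j); ring.
apply: (@pcong_trans _ (a * ((2%:R * a + 1) * (- (2%:R * (j%:R + x) + 1) +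
     2%:R * x * (1 + (2%:R * (j%:R + x) + 1) *
       euler_poly (p - 2) (- (2%:R * (j%:R + x)))))) + 2%:R * x)).
  apply: pcongD.
    apply: pcongMl => //; apply: pcongMl => //.
    by rewrite rpredD ?rpredM ?rpred_nat ?rpred1.
  by apply: pcongMl; rewrite ?rpred_nat //; apply: edge_pcong.
have -> : j%:R + x = a - 1 by rewrite /a -(natr1 j); ring.
(* Two shifts from y = -2 a reach y + 2 = -2 (a - 1): E(y + 2) = E(y) - 2 y^(p-2) + 2 (y + 1)^(p-2),
   where E is E_{p-2}. *)
have e1 := euler_poly_shift (p - 2) (- (2%:R * a)).
have e2 := euler_poly_shift (p - 2) (- (2%:R * a) + 1).
have fermatE y : y * y ^+ (p - 2) = y ^+ p.-1.
  by rewrite -exprS; congr (_ ^+ _); lia.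
have f1 := fermatE (- (2%:R * a)); have f2 := fermatE (- (2%:R * a) + 1).
have -> : - (2%:R * (a - 1)) = - (2%:R * a) + 1 + 1 by ring.
move: e1 => /(canRL (addKr _)) e1; move: e2 => /(canRL (addKr _)).
rewrite {}e1 => ->.
set E0 := euler_poly _ _; set A := _ ^+ p.-1 in f1; set B := _ ^+ p.-1 in f2.
set u := _ ^+ (p - 2) in f1 *; set v := _ ^+ (p - 2) in f2 *.
(* The factors 2 a and 2 a - 1 complete the powers to A = y^(p-1) and B = (y + 1)^(p-1). What
   remains is x times a bracket that is 0 at A = B = 1. *)
have -> : a * ((2%:R * a + 1) * (- (2%:R * (a - 1) + 1) +
   2%:R * x * (1 + (2%:R * (a - 1) + 1) * (- (- E0 + 2%:R * u) + 2%:R * v))))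
   + 2%:R * x =
  a * ((2%:R * a - 1) *
    (- (2%:R * a + 1) + 2%:R * x * (1 + (2%:R * a + 1) * E0))) +
  x * (2%:R * (2%:R * a + 1 + (2%:R * a + 1) * (2%:R * a - 1) * A
    - 2%:R * a * (2%:R * a + 1) * B)).
  by rewrite -f1 -f2; ring.
apply: pcong_addr0; rewrite -(mulr0 x); apply: pcongS_mul => //.
have oppU y : ~~ pcong p 1 y 0 -> ~~ pcong p 1 (- y) 0.
  by apply: contra => /pcongN; rewrite opprK oppr0.
have a1 : pcong p 1 A 1.
  apply: pintegral_fermat; first by rewrite rpredN rpredM ?rpred_nat.
  apply/oppU/(@pcong_unit (2 * j.+1)); last by rewrite gtnNdvd //; lia.
  by rewrite natrM; apply: pcongMl; rewrite ?rpred_nat.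
have b1 : pcong p 1 B 1.
  rewrite /B addrC -opprB; apply: pintegral_fermat; first by rewrite rpredN.
  exact: oppU.
case/pcongP: a1 => A' A'Z ->; case/pcongP: b1 => B' B'Z ->; apply/pcongP.
exists (2%:R * ((2%:R * a + 1) * (2%:R * a - 1) * A'
  - 2%:R * a * (2%:R * a + 1) * B')); last by ring.
by rewrite !(rpredM, rpredB, rpredD, rpred_nat, rpred1).
Qed.

(** * Residues j > m, by the symmetry a -> -1 - a *)

Lemma trunc_sum_pcong_compl j a :
  a \in pintegral p -> pcong p 1 a j%:R -> (m < j < p)%N ->
  pcong p 2 (trunc_sum m a)
    (2%:R * a + 1 + 2%:R * (p%:R + a - j%:R) *
       (1 + (2%:R * a + 1) * euler_poly (p - 2) (- (2%:R * a)))).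
Proof.
move=> aZ aj /andP[lt_mj lt_jp]; rewrite -trunc_sum_compl.
have pjE : (p.-1 - j)%:R = p%:R - 1 - j%:R :> rat.
  by rewrite -subn1 -subnDA natrB ?natrD ?opprD ?addrA.
have a'j : pcong p 1 (-1 - a) (p.-1 - j)%:R.
  rewrite pjE; case/pcongP: aj => u uZ ->; apply/pcongP.
  by exists (-1 - u); [rewrite rpredB ?rpredN1 | ring].
apply: pcong_trans (trunc_sum_pcong a'j _) _; first by lia.
rewrite pjE; set b := 2%:R * a + 1.
have bZ : b \in pintegral p by rewrite rpredD ?rpredM ?rpred_nat ?rpred1.
have bU : ~~ pcong p 1 b 0.
  apply: (@pcong_unit (2 * j).+1).
    rewrite -natr1 natrM; apply: pcongD (pcong_refl _ _).
    by apply: pcongMl; rewrite ?rpred_nat.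
  (* Here p < 2 j + 1 < 2 p. *)
  apply/negP => /dvdnP[q qE].
  have : (0 < q < 2)%N by apply/andP; split; nia.
  by case: q qE => [|[|]] //; lia.
set E := euler_poly (p - 2) (- (2%:R * a)).
(* With E for E_{p-2}: E(b + 1) = 2 b^(p-2) - E(b), and E(b) = -E(1 - b) = -E(-2 a) because p - 2 is
   odd. *)
have bE : b * euler_poly (p - 2) (- (2%:R * (-1 - a))) =
    2%:R * b ^+ p.-1 + b * E.
  have := euler_poly_shift (p - 2) b.
  have -> : - (2%:R * (-1 - a)) = b + 1 by rewrite /b; ring.
  have {1}-> : b = 1 - (- (2%:R * a)) by rewrite /b; ring.
  rewrite euler_poly_compl -signr_odd (_ : odd (p - 2)); last by lia.
  rewrite expr1 mulN1r -/E => /(canRL (addKr _)) ->.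
  rewrite (_ : p.-1 = (p - 2).+1) ?exprS; last by lia.
  by rewrite opprK mulrDr addrC mulrCA.
set w := 2%:R * (-1 - a) + 1; have wE : w = - b by rewrite /w /b; ring.
rewrite wE mulNr bE.
set F := b ^+ p.-1.
(* The factor -1 - a - (p - 1 - j) is divisible by p, so F may be replaced by its value 1 modulo
   p. *)
have -> : - - b + 2%:R * (-1 - a - (p%:R - 1 - j%:R)) *
    (1 - (2%:R * F + b * E)) =
   b + (-1 - a - (p%:R - 1 - j%:R)) * (2%:R * (1 - (2%:R * F + b * E))) by ring.
have -> : b + 2%:R * (p%:R + a - j%:R) * (1 + b * E) =
   b + (-1 - a - (p%:R - 1 - j%:R)) * (2%:R * (1 - (2%:R * 1 + b * E))) by ring.
apply: pcongD; first exact: pcong_refl.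
apply: pcongS_mul; first by move: a'j; rewrite /pcong subr0 pjE.
apply: pcongMl; first exact: rpred_nat.
apply: pcongD; first exact: pcong_refl.
apply/pcongN/pcongD; last exact: pcong_refl.
apply: pcongMl; first exact: rpred_nat.
exact: pintegral_fermat.
Qed.

End Localization.

Theorem theorem4p2 (p : nat) (a : rat)
    (p_prime : prime p) (p_gt3 : (3 < p)%N)
    (aZp : a \in pintegral p) (a_neq0 : ~~ pcong p 1 a 0) :
  let r := presidue p a in
  let S := \sum_(0 <= k < (p.-1 %/ 2).+1)
             gbinom a k * gbinom (-1 - a) k * (1 / (2%:R * k%:R - 1)) in
  let T := 1 + (2%:R * a + 1) * euler_poly (p - 2) (- (2%:R * a)) in
  ((r%:R : rat) < p%:R / 2%:R ->
     pcong p 2 S (- (2%:R * a + 1) + 2%:R * (a - r%:R) * T)) /\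
  ((r%:R : rat) > p%:R / 2%:R ->
     pcong p 2 S (2%:R * a + 1 + 2%:R * (p%:R + a - r%:R) * T)).
Proof.
move=> r S T; have [lt_rp ar] := pcong_presidue p_prime aZp.
rewrite -/r in lt_rp ar.
have odd_p : odd p by case: (even_prime p_prime) p_gt3 => [->|].
rewrite /S; set m := (p.-1 %/ 2)%N; have pE : p = m.*2.+1 by rewrite /m; lia.
(* The comparison of r with p / 2 becomes one of 2 r with p, hence of r with m since p is odd. *)
rewrite ltr_pdivlMr ?ltr_pdivrMr // -!natrM !ltr_nat.
split=> r_p; first by apply: trunc_sum_pcong; rewrite //; lia.
by apply: trunc_sum_pcong_compl; rewrite //; lia.
Qed.
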